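(* Let $[q^{\mathrm C},y^{\mathrm C},w^{\mathrm C},\pi^{\mathrm C},\rho^{\mathrm C}]$ be the solution of $[\text{COST-LCP}]$ and let $[q^{\mathrm F},y^{\mathrm F}]$ be the solution of the linear program $[\text{FLOW-LP}]$ built from $[w^{\mathrm C},\pi^{\mathrm C},\rho^{\mathrm C}]$. Suppose that the generalized queue replacement principle (GQRP) holds. Then $$[q^{\mathrm{UE}},y^{\mathrm{UE}},w^{\mathrm{UE}},\pi^{\mathrm{UE}},\rho^{\mathrm{UE}}]=[q^{\mathrm F},y^{\mathrm F},w^{\mathrm C},\pi^{\mathrm C},\rho^{\mathrm C}]$$ is a solution of $[\text{DUE-LCP}]$.
   Context: **Network.** A directed network has a finite set $\mathcal N$ of $N$ origin nodes, one destination node $d$, and a finite set $\mathcal L$ of $L$ directed links. Link $(i,j)\in\mathcal L$ has bottleneck capacity $\mu_{ij}>0$ and free-flow travel time $c_{ij}\ge 0$. Origin $i$ has demand $Q_i\ge 0$. $\mathcal T$ is the time interval of destination arrival times $t$. The schedule delay cost $s:\mathcal T\to\mathbb R$ is convex, $s(t^{\mathrm P})=0$ for the common preferred arrival time $t^{\mathrm P}$, and $\dot s(t)>-1$ with $\dot s(t)$ finite for all $t$. Vectors $\mu,c\in\mathbb R^L$ and $Q\in\mathbb R^N$ collect these data; the vector $s(t)\in\mathbb R^N$ has all components equal to the scalar $s(t)$; $M=\mathrm{diag}(\mu)$. $A\in\mathbb R^{N\times L}$ is the node-link incidence matrix without the destination row: the entry in row $k$, column $(i,j)$ is $1$ if $k=i$,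 $-1$ if $k=j$, and $0$ otherwise. $A_+$ is $A$ with negative entries replaced by $0$, so $(A_+^\top x)_{ij}=x_i$. By convention $\pi_d(t)=0$. An overdot is $d/dt$. $0\le a\perp b\ge 0$ means $a,b\ge 0$ componentwise and $a^\top b=0$. Products of vectors inside integrals are inner products. Functions of $t$ are assumed regular enough for the integrals and derivatives written to make sense; conditions involving derivatives are imposed where the derivatives exist. **Variables** (indexed by destination arrival time $t$): $q(t)\in\mathbb R^N$ (destination arrival flow by origin), $y(t)\in\mathbb R^L$ (destination arrival flow of users passing each link), $w(t)\in\mathbb R^L$ (queueing delay on each link), $\pi(t)\in\mathbb R^N$ (earliest travel time from each node to the destination), $\rho\in\mathbb R^N$ (equilibrium travel cost of each origin). **$[\text{DUE-LCP}]$**: find $[q,y,w,\pi,\rho]\ge 0$ such that $\int_{\mathcal T} q(t)\,dt=Q$ and, for all $t\in\mathcal T$, - $Ay(t)-q(t)=0$; - $0\le M\dot w(t)-MA_+^\top\dot\pi(t)+\mu-y(t)\perp w(t)\ge 0$; - $\dot\pi(t)\le 1$ (componentwise); - $0\le w(t)-A^\top\pi(t)+c\perp y(t)\ge 0$; - $0\le \pi(t)+s(t)-\rho\perp q(t)\ge 0$. A solution is written $[q^{\mathrm{UE}},y^{\mathrm{UE}},w^{\mathrm{UE}},\pi^{\mathrm{UE}},\rho^{\mathrm{UE}}]$. **$[\text{COST-LCP}]$**: find $[q,y,w,\pi,\rho]\ge 0$ such that $\int_{\mathcal T} q(t)\,dt=Q$ and, for all $t\in\mathcal T$, $Ay(t)-q(t)=0$;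 $0\le\mu-y(t)\perp w(t)\ge 0$; $0\le w(t)-A^\top\pi(t)+c\perp y(t)\ge 0$; $0\le\pi(t)+s(t)-\rho\perp q(t)\ge 0$. Its solution carries the superscript $\mathrm C$. **Convention.** Where $\pi_i(t)$ is not determined by the equilibrium conditions, it is specified as the earliest travel time implied by the queueing delay pattern $w$. **GQRP.** The GQRP holds if the queueing delay pattern $w^{\mathrm{UE}}$ of $[\text{DUE-LCP}]$ equals that of $[\text{COST-LCP}]$: $w^{\mathrm{UE}}(t)=w^{\mathrm C}(t)$ for all $t\in\mathcal T$; that is, $[\text{DUE-LCP}]$ has a solution whose queueing-delay component is $w^{\mathrm C}$. **$[\text{FLOW-LP}]$**: with $\overline\theta(t)=\dot w^{\mathrm C}(t)-A_+^\top\dot\pi^{\mathrm C}(t)+1$ (here $1$ is the all-ones vector), minimize over $[q,y]\ge 0$ $$Z^{\mathrm F}(q,y)=Z^{\mathrm P}(q,y)+Z^{\mathrm Q}(w^{\mathrm C},\pi^{\mathrm C})-Z^{\mathrm D}(w^{\mathrm C},\pi^{\mathrm C},\rho^{\mathrm C})$$ subject to $\int_{\mathcal T} q(t)\,dt=Q$ and, for all $t\in\mathcal T$, $Ay(t)-q(t)=0$ and $M\overline\theta(t)-y(t)\ge 0$, where $Z^{\mathrm P}(q,y)=\int_{\mathcal T}s(t)q(t)\,dt+\int_{\mathcal T}c\,y(t)\,dt$, $Z^{\mathrm Q}(w,\pi)=\int_{\mathcal T}w(t)\,(M\dot w(t))\,dt-\int_{\mathcal T}w(t)\,(MA_+^\top\dot\pi(t))\,dt$,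 $Z^{\mathrm D}(w,\pi,\rho)=-\int_{\mathcal T}\mu\,w(t)\,dt+Q^\top\rho$.
   Formalization: The orthogonality conditions are required only for almost every t, not every t, in assumptions and conclusion (pointwise the claim fails: alter a FLOW-LP minimizer at one time); inequalities hold for all t. In Z^D the constant Q^T rho may have opposite sign; minimizers are unaffected. *)

(* Defs.v *)
From HB Require Import structures.
From mathcomp Require Import all_boot all_order all_algebra.
From mathcomp Require Import all_classical all_reals all_analysis.

Set Implicit Arguments.
Unset Strict Implicit.
Unset Printing Implicit Defensive.
Import Order.TTheory GRing.Theory Num.Theory.
Import numFieldNormedType.Exports.
Local Open Scope classical_set_scope.
Local Open Scope ring_scope.

Definition inner (R : realType) n (u v : 'cV[R]_n) : R := (u^T *m v) 0 0.

Definition ge0 (R : realType) n (u : 'cV[R]_n) : Prop := forall i, 0 <= u i 0.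

(* Origins are the [Some i] with [i : 'I_N]; [None] is the destination.  The
   links form a set of ordered pairs of nodes, enumerated by ['I_L]. *)
Record network (R : realType) (N L : nat) := Network {
  link : 'I_L -> option 'I_N * option 'I_N;
  link_inj : injective link;
  capacity : 'cV[R]_L;
  capacity_gt0 : forall l, 0 < capacity l 0;
  freeflow : 'cV[R]_L;
  freeflow_ge0 : ge0 freeflow;
  demand : 'cV[R]_N;
  demand_ge0 : ge0 demand;
  horizon : interval R;
  pref : R;
  pref_in : pref \in horizon;
  sdc : R -> R;
  sdc_convex : convex_function ([set` horizon] : set R) sdc;
  sdc_pref : sdc pref = 0;
  sdc_deriv : forall t, [set` horizon]° t -> derivable sdc t 1 ->
    -1 < derive1 sdc t }.

Section Model.
Context (R : realType) (N L : nat) (net : network R N L).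
Local Notation leb := (@lebesgue_measure R).
Local Notation mu := (capacity net).
Local Notation c := (freeflow net).
Local Notation Q := (demand net).
Local Notation T := [set` horizon net].
Implicit Types (q pi : R -> 'cV[R]_N) (y w : R -> 'cV[R]_L) (rho : 'cV[R]_N).

Definition tail (l : 'I_L) := (link net l).1.
Definition head (l : 'I_L) := (link net l).2.

Definition incidence : 'M[R]_(N, L) := \matrix_(k, l)
  if tail l == Some k then 1 else if head l == Some k then -1 else 0.
Local Notation A := incidence.
Definition incidence_pos : 'M[R]_(N, L) := map_mx (Num.max 0) A.
Local Notation Ap := incidence_pos.
Definition capmx : 'M[R]_L := diag_mx mu^T.
Local Notation M := capmx.
Definition svec (t : R) : 'cV[R]_N := const_mx (sdc net t).

Fixpoint is_path (x : option 'I_N) (p : seq 'I_L) : bool :=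
  if p is l :: p' then (tail l == x) && is_path (head l) p' else x == None.

Definition path_time (w : 'cV[R]_L) (p : seq 'I_L) : R :=
  \sum_(l <- p) (c l 0 + w l 0).

(* Delays are indexed by the arrival time at the destination, so the travel
   time of a path is evaluated with the delays of one and the same [t]. *)
Definition earliest w pi : Prop := forall t, T t -> forall i,
  (exists2 p, is_path (Some i) p & pi t i 0 = path_time (w t) p) /\
  (forall p, is_path (Some i) p -> pi t i 0 <= path_time (w t) p).

(* Derivatives at an endpoint of the horizon would depend on values outside of
   it; endpoints are therefore left out. *)
Definition diff_times w pi : set R :=
  [set t | [/\ T° t, derivable w t 1 & derivable pi t 1]].

(* Flows are densities in [t]: orthogonality is required for almost every [t],
   the inequalities for every [t] in [D].  Orthogonality for every [t] would
   not survive changing a minimizer of FLOW-LP on a null set. *)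
Definition complementary (D : set R) n (a b : R -> 'cV[R]_n) : Prop :=
  (forall t, D t -> ge0 (a t) /\ ge0 (b t)) /\
  {ae leb, forall t, D t -> inner (a t) (b t) = 0}.

Definition regular_flow q y : Prop :=
  [/\ forall i, leb.-integrable T (EFin \o (fun t => q t i 0)),
      forall l, measurable_fun T (fun t => y t l 0),
      leb.-integrable T (EFin \o (fun t => inner (svec t) (q t))) &
      leb.-integrable T (EFin \o (fun t => inner c (y t)))].

Definition regular_delay w pi : Prop :=
  (forall l, measurable_fun T (fun t => w t l 0)) /\
  (forall i, measurable_fun T (fun t => pi t i 0)) /\
  {ae leb, forall t, T t -> derivable w t 1 /\ derivable pi t 1} /\
  [/\ leb.-integrable T (EFin \o (fun t => inner (w t) (M *m derive1 w t))),
      leb.-integrable T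
        (EFin \o (fun t => inner (w t) (M *m Ap^T *m derive1 pi t))) &
      leb.-integrable T (EFin \o (fun t => inner mu (w t)))].

Definition meets_demand q : Prop :=
  forall i, \int[leb]_(t in T) q t i 0 = Q i 0.

Record DUE_LCP q y w pi rho : Prop := {
  due_flow : regular_flow q y;
  due_delay : regular_delay w pi;
  due_ge0 : forall t, T t ->
    [/\ ge0 (q t), ge0 (y t), ge0 (w t) & ge0 (pi t)];
  due_rho_ge0 : ge0 rho;
  due_earliest : earliest w pi;
  due_demand : meets_demand q;
  due_conservation : forall t, T t -> A *m y t - q t = 0;
  due_queue : complementary (diff_times w pi)
    (fun t => M *m derive1 w t - M *m Ap^T *m derive1 pi t + mu - y t) w;
  due_fifo : forall t, T° t -> derivable pi t 1 ->
    forall i, derive1 pi t i 0 <= 1;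
  due_route : complementary T (fun t => w t - A^T *m pi t + c) y;
  due_departure : complementary T (fun t => pi t + svec t - rho) q }.

Record COST_LCP q y w pi rho : Prop := {
  cost_flow : regular_flow q y;
  cost_delay : regular_delay w pi;
  cost_ge0 : forall t, T t ->
    [/\ ge0 (q t), ge0 (y t), ge0 (w t) & ge0 (pi t)];
  cost_rho_ge0 : ge0 rho;
  cost_earliest : earliest w pi;
  cost_demand : meets_demand q;
  cost_conservation : forall t, T t -> A *m y t - q t = 0;
  cost_queue : complementary T (fun t => mu - y t) w;
  cost_route : complementary T (fun t => w t - A^T *m pi t + c) y;
  cost_departure : complementary T (fun t => pi t + svec t - rho) q }.

Definition GQRP wC : Prop := exists q y w pi rho,
  DUE_LCP q y w pi rho /\ forall t, T t -> w t = wC t.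

Definition theta_bar w pi (t : R) : 'cV[R]_L :=
  derive1 w t - Ap^T *m derive1 pi t + const_mx 1.

Definition ZP q y : R :=
  \int[leb]_(t in T) inner (svec t) (q t) + \int[leb]_(t in T) inner c (y t).

Definition ZQ w pi : R :=
  \int[leb]_(t in T) inner (w t) (M *m derive1 w t)
  - \int[leb]_(t in T) inner (w t) (M *m Ap^T *m derive1 pi t).

Definition ZD w rho : R :=
  - \int[leb]_(t in T) inner mu (w t) + inner Q rho.

Definition ZF wC piC rhoC q y : R := ZP q y + ZQ wC piC - ZD wC rhoC.

Record FLOW_LP_feasible wC piC q y : Prop := {
  flow_regular : regular_flow q y;
  flow_ge0 : forall t, T t -> ge0 (q t) /\ ge0 (y t);
  flow_demand : meets_demand q;
  flow_conservation : forall t, T t -> A *m y t - q t = 0;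
  flow_capacity : forall t, diff_times wC piC t ->
    ge0 (M *m theta_bar wC piC t - y t) }.

Definition FLOW_LP wC piC rhoC q y : Prop :=
  FLOW_LP_feasible wC piC q y /\
  forall q' y', FLOW_LP_feasible wC piC q' y' ->
    ZF wC piC rhoC q y <= ZF wC piC rhoC q' y'.

End Model.

(* Main.v *)
Require Import Defs.
From mathcomp Require Import all_boot all_order all_algebra.
From mathcomp Require Import all_classical all_reals all_analysis.
From mathcomp Require Import ring.

(** The argument is linear programming duality for FLOW-LP.  Its objective
    depends on the flows only through [ZP], and for given delays, travel times
    and origin costs [(w, pi, rho)] that satisfy the sign conditions of the
    route choice and departure time problems, every feasible flow [(q, y)] obeys

      [ZP q y - dual_value w pi rho] = integral of
        [queue_slack . w + route_slack . y + departure_slack . q],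

    where the three summands are nonnegative at almost every time: they are
    exactly the products that DUE-LCP requires to vanish.  The identity holds
    pointwise ([gapE]) because flow conservation [A y = q] turns
    [(A^T pi) . y] into [pi . q].  Therefore a feasible flow satisfies all
    complementarity conditions of DUE-LCP as soon as its cost reaches the dual
    value ([ZP_le_dual_value_complementary]), and conversely the flow of a
    solution of DUE-LCP has precisely that cost ([DUE_LCP_ZP]).

    The GQRP supplies a solution of DUE-LCP with delay [wC].  Travel times are
    shortest path times, so they are determined by the delays, and that
    solution may be rewritten with [(wC, piC)] ([DUE_LCP_eq_delay]); its flow
    is then feasible for FLOW-LP.  Its origin costs [rho] may differ from [rhoC]
    at origins without demand, but both give the same total cost [Q . rho]
    ([departure_cost_le], used in both directions), hence the same dual value.
    So the dual value for [rhoC] is attained by a feasible flow, a minimizer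
    [(qF, yF)] costs no more than that, and complementarity follows.  The
    remaining conditions on [(wC, piC, rhoC)] come from COST-LCP, except
    [piC' <= 1], which is inherited from the solution of DUE-LCP. *)


Set Implicit Arguments.
Unset Strict Implicit.
Unset Printing Implicit Defensive.
Import Order.TTheory GRing.Theory Num.Theory.
Import numFieldNormedType.Exports.
Local Open Scope classical_set_scope.
Local Open Scope ring_scope.

(** * The inner product of column vectors *)

Section Inner.
Context (R : realType).

Lemma innerE n (u v : 'cV[R]_n) : inner u v = \sum_i u i 0 * v i 0.
Proof. by rewrite /inner mxE; apply: eq_bigr => i _; rewrite mxE. Qed.

Lemma innerC n (u v : 'cV[R]_n) : inner u v = inner v u.
Proof. by rewrite !innerE; apply: eq_bigr => i _; rewrite mulrC. Qed.

Lemma innerDl n (u v x : 'cV[R]_n) : inner (u + v) x = inner u x + inner v x.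
Proof. by rewrite /inner linearD mulmxDl mxE. Qed.

Lemma innerNl n (u x : 'cV[R]_n) : inner (- u) x = - inner u x.
Proof. by rewrite /inner linearN mulNmx mxE. Qed.

Lemma inner_trmx m n (B : 'M[R]_(m, n)) u v :
  inner (B^T *m u) v = inner u (B *m v).
Proof. by rewrite /inner trmx_mul trmxK mulmxA. Qed.

Lemma inner_ge0 n (u v : 'cV[R]_n) : Defs.ge0 u -> Defs.ge0 v -> 0 <= inner u v.
Proof.
by move=> u0 v0; rewrite innerE; apply: sumr_ge0 => i _; exact: mulr_ge0.
Qed.

End Inner.

(** * Integrals and properties that hold almost everywhere *)

(* Stated as an instance so that the filter is found whichever of the
   convertible presentations of Lebesgue measure a goal displays. *)
#[local] Instance ae_lebesgue_filter (R : realType) :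
  Filter (nbhs (almost_everywhere (@lebesgue_measure R))).
Proof. exact _. Qed.

Section NullSets.
Context (R : realType).
Local Notation leb := (@lebesgue_measure R).

(** An interval exceeds its interior by at most its two endpoints. *)
Lemma ae_interior_itv (i : interval R) :
  {ae leb, forall t, [set` i] t -> [set` i]° t}.
Proof.
have null (x y : R) (P : R -> Prop) : (forall t, t != x -> t != y -> P t) ->
    {ae leb, forall t, P t}.
  move=> h; exists [set x; y]; split.
  - by apply/measurableU; exact: measurable_set1.
  - by apply/countable_lebesgue_measure0/finite_set_countable/finite_set2.
  - move=> t /= nP; have [->|tx] := eqVneq t x; first by left.
    by right; apply: contra_notP nP => /eqP ty; exact: h.
(* The last cases are the degenerate intervals bounded below by [+oo] or above
   by [-oo], which are empty. *)
case: i => [[a x|[]] [b y|[]]]; rewrite ?interior_itv.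
- apply: (null x y) => t tx ty; rewrite /= !in_itv /=.
  move=> /andP[/lteifW xt /lteifW ty'].
  by rewrite !lt_neqAle xt ty' (eq_sym x) tx ty.
- by apply: (null x x) => t _ _ /=; rewrite in_itv /= andbF.
- apply: (null x x) => t tx _; rewrite /= !in_itv /= !andbT => /lteifW xt.
  by rewrite lt_neqAle xt (eq_sym x) tx.
- apply: (null y y) => t ty _; rewrite /= !in_itv /= => /lteifW ty'.
  by rewrite lt_neqAle ty' ty.
- by apply: (null 0 0) => t _ _ /=; rewrite in_itv.
- by apply: (null 0 0) => t _ _ /=; rewrite !in_itv.
all: by apply: (null 0 0) => t _ _ /=; rewrite in_itv.
Qed.

Lemma ae_ge0_Rintegral_eq0 (D : set (measurableTypeR R)) (f : R -> R) :
  measurable D -> leb.-integrable D (EFin \o f) ->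
  {ae leb, forall t, D t -> 0 <= f t} ->
  \int[leb]_(t in D) f t <= 0 -> {ae leb, forall t, D t -> f t = 0}.
Proof.
move=> mD intf f0 If0.
have mf := measurable_int _ intf.
have absE : (\int[leb]_(t in D) `|(f t)%:E| = \int[leb]_(t in D) (f t)%:E)%E.
  apply: ae_eq_integral => //.
    exact: (measurable_int _ (integrable_abse intf)).
  by apply: filterS f0 => t ft Dt /=; rewrite ger0_norm // ft.
have I0 : (\int[leb]_(t in D) `|(EFin \o f) t| = 0)%E.
  apply/eqP; rewrite eq_le integral_ge0 // andbT /= absE.
  by rewrite -(fineK (integrable_fin_num mD intf)) lee_fin.
apply: filterS (proj1 (ae_eq_integral_abs leb mD mf) I0) => t ft Dt.
by case: (ft Dt).
Qed.

Lemma ae_eq0_Rintegral (D : set (measurableTypeR R)) (f : R -> R) :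
  measurable D -> leb.-integrable D (EFin \o f) ->
  {ae leb, forall t, D t -> f t = 0} -> \int[leb]_(t in D) f t = 0.
Proof.
move=> mD intf f0.
rewrite /Rintegral (ae_eq_integral (cst 0%E)) ?integral0 //.
  exact: measurable_int intf.
by apply: filterS f0 => t ft Dt /=; rewrite ft.
Qed.

Lemma ae_ge0_Rintegral_ge0 (D : set (measurableTypeR R)) (f : R -> R) :
  measurable D -> leb.-integrable D (EFin \o f) ->
  {ae leb, forall t, D t -> 0 <= f t} -> 0 <= \int[leb]_(t in D) f t.
Proof.
move=> mD intf f0; rewrite leNgt; apply/negP => If0.
have := ae_ge0_Rintegral_eq0 mD intf f0 (ltW If0).
by move/(ae_eq0_Rintegral mD intf) => I0; rewrite I0 ltxx in If0.
Qed.

Lemma Rintegral_sum I (s : seq I) (D : set (measurableTypeR R))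
    (h : I -> R -> R) :
  measurable D -> (forall i, leb.-integrable D (EFin \o h i)) ->
  leb.-integrable D (EFin \o (fun t => \sum_(i <- s) h i t)) /\
  \int[leb]_(t in D) (\sum_(i <- s) h i t) =
    \sum_(i <- s) \int[leb]_(t in D) h i t.
Proof.
move=> mD ih; elim: s => [|i s [IHi IHe]].
  have -> : (fun t => \sum_(i <- [::]) h i t) = cst 0.
    by apply/funext => t; rewrite big_nil.
  by rewrite big_nil Rintegral_cst // mul0r; split=> //; exact: integrable0.
have -> : (fun t => \sum_(j <- i :: s) h j t) =
          (fun t => h i t + \sum_(j <- s) h j t).
  by apply/funext => t; rewrite big_cons.
rewrite big_cons -IHe -RintegralD //; split=> //.
exact: (integrableD mD (ih i) IHi).
Qed.

End NullSets.

(** * Equilibria with equal delays *)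

Section Theory.
Context (R : realType) (N L : nat) (net : network R N L).
Local Notation leb := (@lebesgue_measure R).
Local Notation mu := (capacity net).
Local Notation c := (freeflow net).
Local Notation Q := (demand net).
Local Notation T := [set` horizon net].
Local Notation A := (incidence net).
Local Notation Ap := (incidence_pos net).
Local Notation M := (Defs.capmx net).
Implicit Types (q pi : R -> 'cV[R]_N) (y w : R -> 'cV[R]_L) (rho : 'cV[R]_N).

Lemma measurable_horizon : measurable (T : set (measurableTypeR R)).
Proof. exact: measurable_itv. Qed.

Lemma capmx_theta_bar w pi t : M *m theta_bar net w pi t =
  M *m derive1 w t - M *m Ap^T *m derive1 pi t + mu.
Proof.
rewrite /theta_bar mulmxDr mulmxBr mulmxA; congr (_ + _).
by apply/colP => l; rewrite mul_diag_mx !mxE mulr1.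
Qed.

Lemma earliest_uniq w w' pi pi' : (forall t, T t -> w t = w' t) ->
  earliest net w pi -> earliest net w' pi' -> forall t, T t -> pi t = pi' t.
Proof.
move=> ww' wpi wpi' t Tt; apply/colP => i.
have [[p ip pE] pmin] := wpi t Tt i.
have [[p' ip' pE'] pmin'] := wpi' t Tt i.
by apply/le_anti/andP; split; [rewrite pE' -ww' //; exact: pmin
  | rewrite pE ww' //; exact: pmin'].
Qed.

(** The functions may differ outside of the horizon; around an interior time
    they agree on a neighbourhood, which is all that a derivative sees. *)
Lemma eq_horizon_derive1 n (f g : R -> 'cV[R]_n) t :
  (forall u, T u -> f u = g u) -> T° t ->
  (derivable f t 1 <-> derivable g t 1) /\ derive1 f t = derive1 g t.
Proof.
move=> fg Tt.
have nfg : \near t, f t = g t by apply: filterS Tt => u /fg.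
split; last by rewrite !derive1E; exact: near_eq_derive.
split; apply: near_eq_derivable => //.
by apply: filterS nfg => u ->.
Qed.

Lemma complementary_congr n (D D' : set R) (a a' b b' : R -> 'cV[R]_n) :
  D' `<=` D -> (forall t, D' t -> a t = a' t /\ b t = b' t) ->
  complementary D a b -> complementary D' a' b'.
Proof.
move=> DD ab [ab0 abae]; split=> [t Dt|].
  by have [<- <-] := ab t Dt; exact/ab0/DD.
by apply: filterS abae => t ab_t Dt; have [<- <-] := ab t Dt; exact/ab_t/DD.
Qed.

Lemma ae_diff_times w pi : regular_delay net w pi ->
  {ae leb, forall t, T t -> diff_times net w pi t}.
Proof.
case=> _ [_ [dwpi _]].
apply: filterS2 dwpi (ae_interior_itv (horizon net)) => t dt it Tt.
by have [dw dpi] := dt Tt; split; [exact: it | |].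
Qed.

(** Agreement on the horizon suffices: the travel times agree there by
    [earliest_uniq], and the conditions on derivatives only concern interior
    times.  This lets the solution given by the GQRP be compared with FLOW-LP,
    whose capacity constraint is written with the derivatives of [wC] and
    [piC]. *)
Lemma DUE_LCP_eq_delay q y w w' pi pi' rho :
  DUE_LCP net q y w pi rho -> (forall t, T t -> w t = w' t) ->
  regular_delay net w' pi' -> earliest net w' pi' ->
  DUE_LCP net q y w' pi' rho.
Proof.
move=> [rf rd g0 r0 ear dem cons qu fifo route dep] ww' rd' ear'.
have pp' := earliest_uniq ww' ear ear'.
have int : T° `<=` T by exact: interior_subset.
have dw t := eq_horizon_derive1 (t := t) ww'.
have dp t := eq_horizon_derive1 (t := t) pp'.
split; [exact: rf | exact: rd' | | exact: r0 | exact: ear' | exact: dem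
       | exact: cons | | | |].
- by move=> t Tt; rewrite -ww' // -pp' //; exact: g0.
- apply: complementary_congr qu => t [Tt dwt dpt].
    by split; [exact: Tt | apply/(proj1 (dw t Tt)) | apply/(proj1 (dp t Tt))].
  by rewrite (proj2 (dw t Tt)) (proj2 (dp t Tt)) ww' //; exact: int.
- move=> t Tt dpt i; rewrite -(proj2 (dp t Tt)); apply: fifo; first exact: Tt.
  by apply/(proj1 (dp t Tt)).
- by apply: complementary_congr route => t Tt; [exact: Tt | rewrite ww' // pp'].
- by apply: complementary_congr dep => t Tt; [exact: Tt | rewrite pp'].
Qed.

(** * The duality gap of FLOW-LP *)

Lemma Rintegral_flow q y rho : regular_flow net q y -> meets_demand net q ->
  leb.-integrable T (EFin \o (fun t => inner rho (q t))) /\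
  \int[leb]_(t in T) inner rho (q t) = inner Q rho.
Proof.
move=> [iq _ _ _] dem.
have irq i : leb.-integrable T (EFin \o (fun t => rho i 0 * q t i 0)).
  exact: (integrableZl measurable_horizon (rho i 0) (iq i)).
have -> : (fun t => inner rho (q t)) = (fun t => \sum_i rho i 0 * q t i 0).
  by apply/funext => t; rewrite innerE.
have [int ->] := Rintegral_sum (index_enum 'I_N) measurable_horizon irq.
split=> //; rewrite innerC innerE; apply: eq_bigr => i _.
by rewrite RintegralZl ?dem //; exact: measurable_horizon.
Qed.

Definition queue_slack y w pi t : 'cV[R]_L := M *m theta_bar net w pi t - y t.
Definition route_slack w pi t : 'cV[R]_L := w t - A^T *m pi t + c.
Definition departure_slack pi rho t : 'cV[R]_N := pi t + svec net t - rho.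

Definition gap q y w pi rho t : R :=
  inner (queue_slack y w pi t) (w t) + inner (route_slack w pi t) (y t)
  + inner (departure_slack pi rho t) (q t).

(** Both products [w . y] cancel, and by conservation so do [(A^T pi) . y] and
    [pi . q].  What is left only involves functions whose integrability is
    part of [regular_flow] and [regular_delay], so the cancelled products never
    have to be integrated on their own. *)
Lemma gapE q y w pi rho t : A *m y t - q t = 0 -> gap q y w pi rho t =
  inner (svec net t) (q t) + inner c (y t)
  + (inner (w t) (M *m derive1 w t) - inner (w t) (M *m Ap^T *m derive1 pi t))
  - (- inner mu (w t) + inner rho (q t)).
Proof.
move=> /subr0_eq Ayq.
rewrite /gap /queue_slack /route_slack /departure_slack capmx_theta_bar.
rewrite !(innerDl, innerNl) inner_trmx Ayq.
rewrite (innerC (M *m _)) (innerC (M *m _ *m _)) (innerC (y t)); ring.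
Qed.

(** The objective of the linear programming dual of FLOW-LP, in which [w]
    prices the time-dependent capacity [M theta_bar]: [Q . rho] minus the
    integral of [w . M theta_bar]. *)
Definition dual_value w pi rho : R :=
  inner Q rho - \int[leb]_(t in T) inner mu (w t) - ZQ net w pi.

Lemma Rintegral_gap q y w pi rho :
  regular_flow net q y -> regular_delay net w pi -> meets_demand net q ->
  (forall t, T t -> A *m y t - q t = 0) ->
  leb.-integrable T (EFin \o gap q y w pi rho) /\
  \int[leb]_(t in T) gap q y w pi rho t =
    ZP net q y - dual_value w pi rho.
Proof.
move=> rf [_ [_ [_ [iw iwp imu]]]] dem cons.
have [irq Irq] := Rintegral_flow rho rf dem.
case: rf => _ _ isq icy.
have mT := measurable_horizon.
have iD (f g : R -> R) : leb.-integrable T (EFin \o f) ->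
    leb.-integrable T (EFin \o g) -> leb.-integrable T (EFin \o (f \+ g)).
  exact: integrableD.
have iB (f g : R -> R) : leb.-integrable T (EFin \o f) ->
    leb.-integrable T (EFin \o g) -> leb.-integrable T (EFin \o (f \- g)).
  exact: integrableB.
have gapF t : t \in (T : set R) -> gap q y w pi rho t =
    ((inner (svec net t) (q t) + inner c (y t))
     + (inner (w t) (M *m derive1 w t)
        - inner (w t) (M *m Ap^T *m derive1 pi t)))
    - (inner rho (q t) - inner mu (w t)).
  by rewrite inE => Tt; rewrite gapE ?cons // (addrC (- _)).
have iP := iD _ _ isq icy.
have iQ := iB _ _ iw iwp.
have iPQ := iD _ _ iP iQ.
have iDual := iB _ _ irq imu.
split.
  apply: (eq_integrable mT _ _ _ (iB _ _ iPQ iDual)) => t Tt.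
  by rewrite /comp gapF.
apply: (etrans (eq_Rintegral leb gapF)).
rewrite (RintegralB mT iPQ iDual) (RintegralD mT iP iQ) (RintegralD mT isq icy).
rewrite (RintegralB mT iw iwp) (RintegralB mT irq imu) Irq.
by rewrite /ZP /dual_value /ZQ; ring.
Qed.

(** Whenever users of origin [i] arrive, [pi_i + s] equals [rho_i], while it is
    always at least [rho'_i]; hence [(rho - rho') . q >= 0], and integrating
    gives the total costs.  Two equilibria with the same travel times thus have
    the same total cost, even if their [rho] differ where there is no demand. *)
Lemma departure_cost_le q y pi rho rho' :
  regular_flow net q y -> meets_demand net q ->
  complementary T (fun t => pi t + svec net t - rho) q ->
  (forall t, T t -> Defs.ge0 (pi t + svec net t - rho')) ->
  inner Q rho' <= inner Q rho.
Proof.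
move=> rf dem [slack0 slack_q] slack'0.
have [int I] := Rintegral_flow (rho - rho') rf dem.
have : 0 <= inner Q (rho - rho').
  rewrite -I; apply: (ae_ge0_Rintegral_ge0 measurable_horizon int).
  apply: filterS slack_q => t sq Tt.
  have -> : rho - rho' = (pi t + svec net t - rho')
                         - (pi t + svec net t - rho).
    by rewrite opprB [RHS]addrC subrKA.
  rewrite innerDl innerNl sq // subr0; apply: inner_ge0; first exact: slack'0.
  by case: (slack0 t Tt).
by rewrite innerC innerDl innerNl subr_ge0 !(innerC _ Q).
Qed.

(** * Complementary slackness *)

Definition dual_feasible w pi rho : Prop := forall t, T t ->
  [/\ Defs.ge0 (w t), Defs.ge0 (route_slack w pi t) &
      Defs.ge0 (departure_slack pi rho t)].

(** Weak duality and its equality case at once: the gap is a sum of three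
    products that are nonnegative almost everywhere, and its integral is
    nonpositive, so each product vanishes almost everywhere. *)
Lemma ZP_le_dual_value_complementary q y w pi rho :
  FLOW_LP_feasible net w pi q y -> regular_delay net w pi ->
  dual_feasible w pi rho -> ZP net q y <= dual_value w pi rho ->
  [/\ complementary (diff_times net w pi) (queue_slack y w pi) w,
      complementary T (route_slack w pi) y &
      complementary T (departure_slack pi rho) q].
Proof.
move=> [rf qy0 dem cons cap] rd dual ZP_le.
have [igap Igap] := Rintegral_gap rho rf rd dem cons.
have terms0 t : T t -> diff_times net w pi t ->
    [/\ 0 <= inner (queue_slack y w pi t) (w t),
        0 <= inner (route_slack w pi t) (y t) &
        0 <= inner (departure_slack pi rho t) (q t)].
  move=> Tt Dt; have [w0 rs0 ds0] := dual t Tt; have [q0 y0] := qy0 t Tt.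
  by split; apply: inner_ge0 => //; exact: cap.
have gap0 : {ae leb, forall t, T t -> 0 <= gap q y w pi rho t}.
  apply: filterS (ae_diff_times rd) => t Dt Tt.
  have [a0 b0 d0] := terms0 t Tt (Dt Tt).
  by rewrite /gap !addr_ge0.
have gapeq0 : {ae leb, forall t, T t -> gap q y w pi rho t = 0}.
  apply: ae_ge0_Rintegral_eq0 igap gap0 _; first exact: measurable_horizon.
  by rewrite Igap subr_le0.
have terms_eq0 : {ae leb, forall t, T t ->
    [/\ inner (queue_slack y w pi t) (w t) = 0,
        inner (route_slack w pi t) (y t) = 0 &
        inner (departure_slack pi rho t) (q t) = 0]}.
  apply: filterS2 (ae_diff_times rd) gapeq0 => t Dt gt Tt.
  have [a0 b0 d0] := terms0 t Tt (Dt Tt).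
  have /eqP := gt Tt; rewrite /gap paddr_eq0 ?addr_ge0 //.
  by rewrite paddr_eq0 // => /andP[/andP[/eqP ? /eqP ?] /eqP ?].
split; split=> [t Dt|].
- have Tt : T t by case: Dt => /interior_subset.
  by split; [exact: cap | case: (dual t Tt)].
- apply: filterS terms_eq0 => t e Dt.
  have Tt : T t by case: Dt => /interior_subset.
  by case: (e Tt).
- by split; [case: (dual t Dt) | case: (qy0 t Dt)].
- by apply: filterS terms_eq0 => t e Tt; case: (e Tt).
- by split; [case: (dual t Dt) | case: (qy0 t Dt)].
- by apply: filterS terms_eq0 => t e Tt; case: (e Tt).
Qed.

Lemma queue_slackE y w pi : queue_slack y w pi =
  (fun t => M *m derive1 w t - M *m Ap^T *m derive1 pi t + mu - y t).
Proof. by apply/funext => t; rewrite /queue_slack capmx_theta_bar. Qed.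

(** The queueing condition of DUE-LCP contains the capacity constraint of
    FLOW-LP. *)
Lemma DUE_LCP_feasible q y w pi rho : DUE_LCP net q y w pi rho ->
  FLOW_LP_feasible net w pi q y.
Proof.
move=> [rf rd g0 r0 ear dem cons [qu _] fifo route dep]; split=> //.
  by move=> t /g0[].
by move=> t /qu[]; rewrite -(congr1 (@^~ t) (queue_slackE y w pi)).
Qed.

Lemma DUE_LCP_ZP q y w pi rho : DUE_LCP net q y w pi rho ->
  ZP net q y = dual_value w pi rho.
Proof.
move=> [rf rd g0 r0 ear dem cons [_ qu] fifo [_ route] [_ dep]].
have [igap Igap] := Rintegral_gap rho rf rd dem cons.
apply/eqP; rewrite -subr_eq0 -Igap; apply/eqP.
apply: (ae_eq0_Rintegral measurable_horizon igap).
have route_dep : {ae leb, forall t, T t ->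
    inner (route_slack w pi t) (y t) = 0 /\
    inner (departure_slack pi rho t) (q t) = 0}.
  by apply: filterS2 route dep => t rt dt Tt; split; [exact: rt | exact: dt].
apply: filterS3 (ae_diff_times rd) qu route_dep => t Dt qt rdt Tt.
have [rt dt] := rdt Tt.
by rewrite /gap queue_slackE rt dt qt ?addr0 //; exact: Dt.
Qed.

End Theory.

Theorem corollary3p1 (R : realType) (N L : nat) (net : network R N L)
    (qC : R -> 'cV[R]_N) (yC wC : R -> 'cV[R]_L) (piC : R -> 'cV[R]_N)
    (rhoC : 'cV[R]_N) (qF : R -> 'cV[R]_N) (yF : R -> 'cV[R]_L) :
  COST_LCP net qC yC wC piC rhoC ->
  FLOW_LP net wC piC rhoC qF yF ->
  GQRP net wC ->
  DUE_LCP net qF yF wC piC rhoC.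
Proof.
move=> [rfC rdC g0C r0C earC demC _ _ [routeC _] depC] [feasF minF].
move=> [q [y [w [pi [rho [due ww]]]]]].
have {}due := DUE_LCP_eq_delay due ww rdC earC.
have rhoE : inner (demand net) rho = inner (demand net) rhoC.
  apply/le_anti/andP; split.
    apply: departure_cost_le rfC demC depC _ => t.
    by case: (due_departure due) => h _ /h[].
  apply: departure_cost_le (due_flow due) (due_demand due) _ _.
    exact: due_departure due.
  by move=> t; case: depC => h _ /h[].
have ZP_le : ZP net qF yF <= dual_value net wC piC rhoC.
  have -> : dual_value net wC piC rhoC = dual_value net wC piC rho.
    by rewrite /dual_value rhoE.
  rewrite -(DUE_LCP_ZP due).
  (* The other terms of the objective do not depend on the flows. *)
  have := minF _ _ (DUE_LCP_feasible due).
  by rewrite /ZF !lerD2r.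
have dual : dual_feasible net wC piC rhoC.
  move=> t Tt; have [_ _ w0 _] := g0C t Tt.
  by split=> //; [case: (routeC t Tt) | case: (proj1 depC t Tt)].
have [quF rtF dpF] := ZP_le_dual_value_complementary feasF rdC dual ZP_le.
case: feasF => rfF qy0 demF consF capF.
split; [exact: rfF | exact: rdC | | exact: r0C | exact: earC | exact: demF
       | exact: consF | | | exact: rtF | exact: dpF].
- by move=> t Tt; have [q0 y0] := qy0 t Tt; have [_ _ w0 p0] := g0C t Tt.
- by rewrite -queue_slackE.
- exact: due_fifo due.
Qed.
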